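(* Let $P,R,S$ be real $n\times n$ matrices with $P$ and $S$ symmetric, and define the real $2n\times 2n$ matrices $$M_r=\begin{bmatrix} R & -S\\ P & R^T\end{bmatrix},\qquad \hat{H}_r=\begin{bmatrix}0& I_n\\ I_n&0\end{bmatrix}.$$ Assume that $S$ is positive semidefinite and that the pair $(R,S)$ is controllable. Then the following are equivalent. (i) The equation $XSX-XR+R^TX+P=0$ has a real skew-symmetric $n\times n$ solution $X$. (ii) There exists an $n$-dimensional $M_r$-invariant $\hat{H}_r$-neutral subspace of $\mathbb{R}^{2n}$.
   Context: A pair $(A,B)$ with $A$ real $n\times n$ and $B$ real $n\times m$ is controllable if $\operatorname{rank}\begin{bmatrix}B& AB& A^2B&\cdots&A^{n-1}B\end{bmatrix}=n$. For a real symmetric $N\times N$ matrix $H$, a subspace $\mathcal{M}\subseteq\mathbb{R}^N$ is $H$-neutral if $\langle Hx,x\rangle=0$ for all $x\in\mathcal{M}$, where $\langle x,y\rangle=y^Tx$. A subspace $\mathcal{M}$ is $M_r$-invariant if $M_r\mathcal{M}\subseteq\mathcal{M}$. *)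

(* Defs.v *)
From mathcomp Require Import all_boot all_order all_algebra.
From mathcomp Require Import reals.

Set Implicit Arguments.
Unset Strict Implicit.
Unset Printing Implicit Defensive.

Import Order.TTheory GRing.Theory Num.Theory.
Local Open Scope ring_scope.

Definition dotp (R : realType) (N : nat) (x y : 'cV[R]_N) : R :=
  (y^T *m x) 0 0.

Definition posSemidef (R : realType) (N : nat) (H : 'M[R]_N) : Prop :=
  H \is symmetricmx /\ forall x : 'cV[R]_N, 0 <= dotp (H *m x) x.

Definition controllability_mx (R : realType) (n m : nat)
    (A : 'M[R]_n) (B : 'M[R]_(n, m)) : 'M[R]_(n, \sum_(j < n) m) :=
  \mxrow_(j < n) (A ^+ j *m B).

Definition controllable (R : realType) (n m : nat)
    (A : 'M[R]_n) (B : 'M[R]_(n, m)) : Prop :=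
  \rank (controllability_mx A B) = n.

(* Matrices act on column vectors, on the left (unlike in mxalgebra, where
   subspaces are row spaces). *)
Definition invariant_subspace (R : realType) (N : nat)
    (M : 'M[R]_N) (W : {vspace 'cV[R]_N}) : Prop :=
  forall x : 'cV[R]_N, x \in W -> M *m x \in W.

Definition neutral_subspace (R : realType) (N : nat)
    (H : 'M[R]_N) (W : {vspace 'cV[R]_N}) : Prop :=
  forall x : 'cV[R]_N, x \in W -> dotp (H *m x) x = 0.

Definition Mr (K : realType) (n : nat) (P R S : 'M[K]_n) : 'M[K]_(n + n) :=
  block_mx R (- S) P R^T.

Definition Hr (K : realType) (n : nat) : 'M[K]_(n + n) :=
  block_mx 0 1%:M 1%:M 0.

(* Main.v *)
Require Import Defs.
From mathcomp Require Import all_boot all_order all_algebra.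
From mathcomp Require Import reals.

Set Implicit Arguments.
Unset Strict Implicit.
Unset Printing Implicit Defensive.

Import Order.TTheory GRing.Theory Num.Theory.
Local Open Scope ring_scope.

(** Both conditions on a subspace become transparent once it is the graph
    {(x, X x)} of an n x n matrix X: since M_r (x, X x) is the vector
    (R x - S X x, P x + R^T X x), invariance of the graph is exactly the
    Riccati equation ([graph_invariant]), and since the form of Hr at
    (x, X x) is twice the form of X at x, neutrality is exactly
    skew-symmetry of X ([graph_neutral]).  A solution X therefore yields its
    graph as the required subspace, and conversely it suffices to show that
    every n-dimensional invariant neutral subspace W is a graph.

    By a dimension count ([graph_of_transversal]) W is a graph as soon as it
    contains no nonzero vector (0, y), and this is where S >= 0 and
    controllability enter ([neutral_invariant_transversal]).  If (0, y) is in
    W, then so is M_r (0, y) = (- S y, R^T y); a neutral subspace is isotropic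
    for the polarized form ([neutral_polar]), and pairing these two vectors
    gives y^T S y = 0, hence S y = 0 because S is positive semidefinite
    ([psd_ker]).  So (0, R^T y) is again in W: the set of such y is stable
    under R^T and killed by S.  Thus y^T R^j S = 0 for every j, and
    controllability forces y = 0 ([controllable_ker]). *)

Section InnerProduct.
Variables (K : realType) (N : nat).
Implicit Types (A H : 'M[K]_N) (x y z : 'cV[K]_N).

Lemma dotpC x y : dotp x y = dotp y x.
Proof. by rewrite /dotp -[in LHS](trmxK x) -trmx_mul mxE. Qed.

Lemma dotpDl x y z : dotp (x + y) z = dotp x z + dotp y z.
Proof. by rewrite /dotp mulmxDr mxE. Qed.

Lemma dotpDr x y z : dotp x (y + z) = dotp x y + dotp x z.
Proof. by rewrite dotpC dotpDl !(dotpC x). Qed.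

Lemma dotpZl a x y : dotp (a *: x) y = a * dotp x y.
Proof. by rewrite /dotp -scalemxAr mxE. Qed.

Lemma dotpZr a x y : dotp x (a *: y) = a * dotp x y.
Proof. by rewrite dotpC dotpZl dotpC. Qed.

Lemma dotp0l x : dotp 0 x = 0.
Proof. by rewrite /dotp mulmx0 mxE. Qed.

Lemma dotp_trmx A x y : dotp (A *m x) y = dotp x (A^T *m y).
Proof. by rewrite /dotp trmx_mul trmxK mulmxA. Qed.

Lemma dotpE x y : dotp x y = \sum_i x i 0 * y i 0.
Proof. by rewrite /dotp mxE; apply: eq_bigr => i _; rewrite mxE mulrC. Qed.

Lemma dotpxx_ge0 x : 0 <= dotp x x.
Proof. by rewrite dotpE sumr_ge0 // => i _; rewrite -expr2 sqr_ge0. Qed.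

Lemma dotpxx_eq0 x : dotp x x = 0 -> x = 0.
Proof.
rewrite dotpE => /eqP; rewrite psumr_eq0 => [/allP x0|i _]; last first.
  by rewrite -expr2 sqr_ge0.
apply/matrixP => i j; rewrite ord1 mxE; apply/eqP.
by have := x0 i (mem_index_enum i); rewrite /= mulf_eq0 orbb.
Qed.

Lemma dotp_mx_eq0 A : (forall x y, dotp (A *m x) y = 0) -> A = 0.
Proof.
move=> A0; apply/matrixP => i j.
have /(congr1 (fun v : 'cV_N => v i 0)) := dotpxx_eq0 (A0 (delta_mx j 0) _).
by rewrite -colE !mxE.
Qed.

Lemma tr_symmetricmx A : A \is symmetricmx -> A^T = A.
Proof. by rewrite is_hermitianmxE expr0 scale1r map_mx_id // => /eqP/esym. Qed.

Lemma skewmxE A : (A \is skewmx) = (A^T == - A).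
Proof.
by rewrite is_hermitianmxE expr1 scaleN1r map_mx_id // eq_sym eqr_oppLR.
Qed.

(** Polarization: a quadratic form that vanishes on a subspace has a
    symmetric bilinear form that vanishes there, because the value at x + y
    is twice the mixed term. *)
Lemma neutral_polar H (W : {vspace 'cV[K]_N}) x y :
  H \is symmetricmx -> neutral_subspace H W ->
  x \in W -> y \in W -> dotp (H *m x) y = 0.
Proof.
move=> /tr_symmetricmx HT neuW xW yW.
have := neuW _ (memvD xW yW).
rewrite mulmxDr dotpDl !dotpDr !neuW // add0r addr0.
by rewrite (dotp_trmx H y) HT (dotpC y) -mulr2n => /eqP; rewrite mulrn_eq0 => /eqP.
Qed.

(** With z = H x, the value of the form at x + t z is
    2 t |z|^2 + t^2 <H z, z>; it is nonnegative for every real t, which is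
    impossible for small negative t unless the linear coefficient |z|^2
    vanishes. *)
Lemma psd_ker H x : posSemidef H -> dotp (H *m x) x = 0 -> H *m x = 0.
Proof.
move=> [/tr_symmetricmx HT H_ge0] xHx; apply: dotpxx_eq0.
set z := H *m x; set a := dotp z z; set b := dotp (H *m z) z.
have b1 : 0 < b + 1 by rewrite ltr_wpDl ?ltr01 // H_ge0.
have a0 : 0 <= a by exact: dotpxx_ge0.
have quad t : 0 <= t * (a *+ 2 + t * b).
  have := H_ge0 (x + t *: z).
  rewrite mulmxDr -scalemxAr dotpDl !dotpDr !dotpZl !dotpZr xHx.
  by rewrite (dotp_trmx H z) HT -/z -/a -/b add0r -!mulrDr addrA -mulr2n.
(* This t makes a *+ 2 + t * b at least a; the 1 keeps the denominator nonzero
   when b = 0. *)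
have := quad (- (a / (b + 1))).
rewrite mulNr oppr_ge0 => le0; apply/eqP; rewrite eq_le a0 andbT leNgt.
apply/negP => a_gt0; move: le0; apply/negP; rewrite -ltNge mulr_gt0 ?divr_gt0 //.
rewrite mulNr mulr2n -addrA ltr_pwDl // subr_ge0 mulrAC ler_pdivrMr //.
by rewrite ler_pM2l // lerDl ler01.
Qed.

End InnerProduct.

(** The controllability matrix has full row rank, so its left kernel, the
    common left kernel of its blocks, is trivial. *)
Lemma controllable_ker (K : realType) (n m : nat) (A : 'M[K]_n)
    (B : 'M[K]_(n, m)) (y : 'rV[K]_n) :
  controllable A B -> (forall j, y *m (A ^+ j *m B) = 0) -> y = 0.
Proof.
rewrite /controllable => /eqP rk yAB; apply: (row_free_inj rk).
by rewrite mul0mx /controllability_mx mul_mxrow -mxrow0; apply: eq_mxrow => j.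
Qed.

Lemma dotp_Hr (K : realType) (n : nat) (x1 x2 y1 y2 : 'cV[K]_n) :
  dotp (Hr K n *m col_mx x1 x2) (col_mx y1 y2) = dotp x2 y1 + dotp x1 y2.
Proof.
rewrite /Hr mul_block_col !mul0mx !mul1mx addr0 add0r /dotp.
by rewrite tr_col_mx mul_row_col mxE.
Qed.

Lemma Hr_sym (K : realType) (n : nat) : Hr K n \is symmetricmx.
Proof.
rewrite is_hermitianmxE expr0 scale1r map_mx_id // /Hr tr_block_mx.
by rewrite !trmx0 !trmx1.
Qed.

Lemma dim_cV (K : fieldType) (n : nat) : dim 'cV[K]_n = n.
Proof. exact: etrans (dim_matrix _ _ _) (muln1 n). Qed.

(** A subspace of dimension n that meets the second factor trivially projects
    isomorphically onto the first factor; the matrix of the inverse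
    isomorphism followed by the second projection is X. *)
Lemma graph_of_transversal (K : fieldType) (n m : nat)
    (W : {vspace 'cV[K]_(n + m)}) :
    \dim W = n -> (forall y : 'cV[K]_m, col_mx 0 y \in W -> y = 0) ->
  exists X : 'M[K]_(m, n),
    forall (x : 'cV[K]_n) (y : 'cV[K]_m), (col_mx x y \in W) = (y == X *m x).
Proof.
move=> dimW transW.
pose f : 'Hom('cV[K]_(n + m), 'cV[K]_n) := linfun usubmx.
have fW : (f @: W = fullv)%VS.
  apply/eqP; rewrite eqEdim subvf dimvf dim_cV limg_dim_eq ?dimW ?leqnn //.
  apply/eqP; rewrite -subv0; apply/subvP => w.
  rewrite memv_cap memv_ker lfunE /= memv0 => /andP[wW /eqP w0].
  move: wW; rewrite -[w]vsubmxK w0 => /transW ->.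
  by rewrite col_mx0.
(* The columns of X are the second components of lifts of the basis vectors. *)
have lift i : exists w, (w \in W) && (usubmx w == delta_mx i 0).
  have /memv_imgP[w wW] : delta_mx i 0 \in (f @: W)%VS by rewrite fW memvf.
  by rewrite lfunE /= => ->; exists w; rewrite wW eqxx.
have [w wP] := fin_all_exists lift.
pose X : 'M[K]_(m, n) := \matrix_(k, i) dsubmx (w i) k 0.
have graph x : col_mx x (X *m x) \in W.
  have -> : col_mx x (X *m x) = \sum_i x i 0 *: w i.
    rewrite -[RHS]vsubmxK !linear_sum /=; congr col_mx.
      rewrite [LHS]matrix_sum_delta; apply: eq_bigr => i _.
      by rewrite big_ord1 linearZ /=; have /andP[_ /eqP->] := wP i.
    apply/matrixP => k j; rewrite ord1 mxE summxE; apply: eq_bigr => i _.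
    by rewrite linearZ /= !mxE mulrC.
  by apply: memv_suml => i _; apply: memvZ; have /andP[] := wP i.
exists X => x y; apply/idP/eqP => [xyW|-> //].
apply/eqP; rewrite -subr_eq0; apply/eqP/transW.
by rewrite -(subrr x) -add_col_mx -opp_col_mx memvB.
Qed.

(** The vectors y with (0, y) in W form an R^T-stable subspace of the kernel
    of S, that is, an unobservable subspace of the dual pair (R^T, S). *)
Lemma neutral_invariant_transversal (K : realType) (n : nat) (P R S : 'M[K]_n)
    (W : {vspace 'cV[K]_(n + n)}) (y : 'cV[K]_n) :
    posSemidef S -> controllable R S ->
    invariant_subspace (Mr P R S) W -> neutral_subspace (Hr K n) W ->
  col_mx 0 y \in W -> y = 0.
Proof.
move=> psdS ctrl invW neuW yW.
have step z : col_mx 0 z \in W -> S *m z = 0 /\ col_mx 0 (R^T *m z) \in W.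
  move=> zW; have := invW _ zW.
  rewrite /Mr mul_block_col !mulmx0 !add0r mulNmx => MzW.
  have Sz0 : S *m z = 0.
    apply: psd_ker => //; apply/oppr_inj.
    have := neutral_polar (Hr_sym K n) neuW zW MzW.
    by rewrite dotp_Hr dotp0l addr0 -scaleN1r dotpZr mulN1r dotpC oppr0.
  by split=> //; move: MzW; rewrite Sz0 oppr0.
have iterW j : col_mx 0 ((R ^+ j)^T *m y) \in W.
  elim: j => [|j /step[_]]; first by rewrite expr0 trmx1 mul1mx.
  by rewrite mulmxA -trmx_mul -[R ^+ j *m R]/(R ^+ j * R) -exprSr.
apply: trmx_inj; rewrite trmx0; apply: (controllable_ker ctrl) => j.
have [Sz0 _] := step _ (iterW j).
case: psdS => /tr_symmetricmx ST _; apply: trmx_inj.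
by rewrite !trmx_mul ST trmxK -mulmxA Sz0 trmx0.
Qed.

(** The vector M_r (x, X x) deviates from the graph, in its second component,
    by the left side of the Riccati equation applied to x. *)
Lemma graph_invariant (K : realType) (n : nat) (P R S X : 'M[K]_n)
    (W : {vspace 'cV[K]_(n + n)}) :
    (forall x y, (col_mx x y \in W) = (y == X *m x)) ->
  invariant_subspace (Mr P R S) W <->
  X *m S *m X - X *m R + R^T *m X + P = 0.
Proof.
move=> graphW.
have MW x : (Mr P R S *m col_mx x (X *m x) \in W) =
    ((X *m S *m X - X *m R + R^T *m X + P) *m x == 0).
  rewrite /Mr mul_block_col graphW -subr_eq0; congr (_ == 0).
  rewrite mulNmx mulmxBr !mulmxDl !mulNmx !mulmxA opprB.
  by rewrite [LHS]addrC (addrC (P *m x)) addrA.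
split=> [invW|ricc w].
  apply/matrixP => i j.
  have := invW (col_mx (delta_mx j 0) (X *m delta_mx j 0)).
  rewrite graphW eqxx MW -colE => /(_ isT)/eqP/matrixP/(_ i 0).
  by rewrite !mxE.
by rewrite -[w]vsubmxK graphW => /eqP ->; rewrite MW ricc mul0mx.
Qed.

(** On the graph, the bilinear form of Hr at (x, X x) and (y, X y) is that of
    X + X^T at x and y. *)
Lemma graph_neutral (K : realType) (n : nat) (X : 'M[K]_n)
    (W : {vspace 'cV[K]_(n + n)}) :
    (forall x y, (col_mx x y \in W) = (y == X *m x)) ->
  neutral_subspace (Hr K n) W <-> X \is skewmx.
Proof.
move=> graphW; rewrite skewmxE; split=> [neuW|/eqP XT w].
  rewrite -addr_eq0 addrC; apply/eqP/dotp_mx_eq0 => x y.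
  rewrite mulmxDl dotpDl (dotp_trmx X^T) trmxK -dotp_Hr.
  by apply: (neutral_polar (Hr_sym K n) neuW); rewrite graphW.
rewrite -[w]vsubmxK graphW => /eqP ->.
rewrite dotp_Hr [in X in X + _]dotp_trmx XT -dotpDr mulNmx addNr.
by rewrite dotpC dotp0l.
Qed.

Lemma graph_subspace (K : fieldType) (n m : nat) (X : 'M[K]_(m, n)) :
  exists2 W : {vspace 'cV[K]_(n + m)}, \dim W = n &
    forall (x : 'cV[K]_n) (y : 'cV[K]_m), (col_mx x y \in W) = (y == X *m x).
Proof.
pose f : 'Hom('cV[K]_n, 'cV[K]_(n + m)) := linfun (mulmx (col_mx 1%:M X)).
have fE x : f x = col_mx x (X *m x) by rewrite lfunE /= mul_col_mx mul1mx.
exists (limg f).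
  rewrite limg_dim_eq ?dimvf ?dim_cV //.
  have /eqP -> : lker f == 0%VS; last exact: capv0.
  by apply/lker0P => x y; rewrite !fE => /eq_col_mx[].
move=> x y; apply/memv_imgP/eqP => [[z _]|->].
  by rewrite fE => /eq_col_mx[-> ->].
by exists x; rewrite ?memvf ?fE.
Qed.

Theorem theorem2p10 (K : realType) (n : nat) (P R S : 'M[K]_n)
    (symP : P \is symmetricmx) (symS : S \is symmetricmx)
    (psdS : posSemidef S) (ctrl : controllable R S) :
  (exists X : 'M[K]_n, X \is skewmx /\
     X *m S *m X - X *m R + R^T *m X + P = 0)
  <->
  (exists W : {vspace 'cV[K]_(n + n)},
     [/\ \dim W = n, invariant_subspace (Mr P R S) W &
         neutral_subspace (Hr K n) W]).
Proof.
split=> [[X [skewX ricc]]|[W [dimW invW neuW]]].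
  have [W dimW graphW] := graph_subspace X.
  exists W; split=> //; first exact/(graph_invariant _ _ _ graphW).
  exact/(graph_neutral graphW).
have [X graphW] := graph_of_transversal dimW
  (fun y => neutral_invariant_transversal psdS ctrl invW neuW).
exists X; split; first exact/(graph_neutral graphW).
exact/(graph_invariant _ _ _ graphW).
Qed.
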